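(* Let $(A_1, \cdot_1, \varepsilon, \alpha_1)$ and $(A_2, \cdot_2, \varepsilon, \alpha_2)$ be two Hom-associative color algebras (graded by the same abelian group $G$ and with the same bicharacter $\varepsilon$). Then $A=A_1\otimes A_2$ is a Hom-associative color algebra (with bicharacter $\varepsilon$) for the twisting map $\alpha:=\alpha_1\otimes\alpha_2 : A\to A$ and the product $\ast : A\otimes A\to A$ defined, on homogeneous elements $a_1,b_1\in A_1$ and $a_2,b_2\in A_2$, by $$\alpha(a_1\otimes a_2):=\alpha_1(a_1)\otimes\alpha_2(a_2),\qquad (a_1\otimes a_2)\ast(b_1\otimes b_2):=\varepsilon(a_2, b_1)\,(a_1\cdot_1 b_1)\otimes (a_2\cdot_2 b_2).$$
   Context: All vector spaces are over a field $\mathbb{K}$ of characteristic different from $2$, $G$ is an abelian group, and a linear map or bilinear map between $G$-graded spaces is called even if it preserves degree (a bilinear product $\mu$ is even if $\mu(A_a,A_b)\subset A_{a+b}$). $\mathcal{H}(A)$ denotes the set of homogeneous elements of a $G$-graded space $A$. A tensor product of graded spaces carries the total grading. A bicharacter (skew-symmetric bicharacter, commutation factor) on $G$ is a map $\varepsilon:G\times G\to\mathbb{K}^*$ with $\varepsilon(a,b)\varepsilon(b,a)=1$, $\varepsilon(a,b+c)=\varepsilon(a,b)\varepsilon(a,c)$, $\varepsilon(a+b,c)=\varepsilon(a,c)\varepsilon(b,c)$ for all $a,b,c\in G$. For homogeneous $x,y$ of degrees $a,b$ one writes $\varepsilon(x,y):=\varepsilon(a,b)$. A Hom-associative color algebra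 $(A,\mu,\varepsilon,\alpha)$ is a $G$-graded linear space $A$ with an even bilinear map $\mu:A\times A\to A$, a bicharacter $\varepsilon$ on $G$ and an even linear map $\alpha:A\to A$ such that $\mu(\alpha(x),\mu(y,z))=\mu(\mu(x,y),\alpha(z))$ for all $x,y,z\in\mathcal{H}(A)$. *)

(* Defs.v *)
From HB Require Import structures.
From mathcomp Require Import all_boot all_order all_algebra.
From mathcomp Require Import finmap boolp classical_sets.
From mathcomp.multinomials Require Import freeg.

Set Implicit Arguments.
Unset Strict Implicit.
Unset Printing Implicit Defensive.

Import GRing.Theory.
Local Open Scope ring_scope.
Local Open Scope quotient_scope.

Definition is_subspace (K : fieldType) (V : lmodType K) (P : set V) : Prop :=
  P 0 /\ forall (k : K) (x y : V), P x -> P y -> P (k *: x + y).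

(* The tensor product of two vector spaces of arbitrary dimension: the quotient
   of the free vector space on U * V by the smallest subspace containing the
   bilinearity relations. *)
Section Tensor.
Context (K : fieldType) (U V : lmodType K).

Local Notation free := {freeg (U * V)%type / K}.

Definition bilinearity_relations (P : set free) : Prop :=
  (forall (k : K) (u u' : U) (v : V),
     P (<< (k *: u + u', v) >> - (k *: << (u, v) >> + << (u', v) >>))) /\
  (forall (k : K) (u : U) (v v' : V),
     P (<< (u, k *: v + v') >> - (k *: << (u, v) >> + << (u, v') >>))).

Definition tensor_rel : {pred free} := fun z =>
  `[< forall P : set free, is_subspace P -> bilinearity_relations P -> P z >].

Fact tensor_rel_sub : is_subspace (fun z => z \in tensor_rel).
Proof.
split=> [|k x y /asboolP hx /asboolP hy]; apply/asboolP => P sP rP.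
  by case: sP.
by case: (sP) => _; apply; [apply: hx | apply: hy].
Qed.

Fact tensor_relP : bilinearity_relations (fun z => z \in tensor_rel).
Proof. by split=> *; apply/asboolP => P _ [h1 h2]; [exact: h1|exact: h2]. Qed.

Fact tensor_rel_zmod : zmod_closed tensor_rel.
Proof.
case: tensor_rel_sub => h0 h; split=> // x y hx hy.
by rewrite addrC -scaleN1r h.
Qed.

HB.instance Definition _ := GRing.isZmodClosed.Build free tensor_rel
  tensor_rel_zmod.

Definition tensor : Type := Quotient.quot tensor_rel.

HB.instance Definition _ := GRing.Zmodule.on tensor.

Local Notation pi := (\pi_(Quotient.quot tensor_rel) : free -> tensor).

Fact tensor_pi_eq (x y : free) : x - y \in tensor_rel -> pi x = pi y.
Proof. by rewrite Quotient.idealrBE => /eqP. Qed.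

Definition tensor_scale (k : K) (t : tensor) : tensor :=
  pi (k *: repr (t : Quotient.quot tensor_rel)).

Fact tensor_pi_scale k x : tensor_scale k (pi x) = pi (k *: x).
Proof.
apply: tensor_pi_eq; rewrite -scalerBr -[_ *: _]addr0.
case: tensor_rel_sub => h0 h; apply: h => //.
by rewrite Quotient.idealrBE reprK.
Qed.

Fact tensor_pi_add (x y : free) : pi (x + y) = pi x + pi y.
Proof. exact: (raddfD \pi_(Quotient.quot tensor_rel)). Qed.

Fact tensor_pi_surj (P : tensor -> Prop) : (forall x, P (pi x)) -> forall t, P t.
Proof.
move=> h t; rewrite -[t](@reprK _ (Quotient.quot tensor_rel)); exact: h.
Qed.

Fact tensor_scaleA k l t :
  tensor_scale k (tensor_scale l t) = tensor_scale (k * l) t.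
Proof. by elim/tensor_pi_surj: t => x; rewrite !tensor_pi_scale scalerA. Qed.

Fact tensor_scale1 : left_id 1 tensor_scale.
Proof. by elim/tensor_pi_surj => x; rewrite tensor_pi_scale scale1r. Qed.

Fact tensor_scaleDr : right_distributive tensor_scale +%R.
Proof.
move=> k; elim/tensor_pi_surj => x; elim/tensor_pi_surj => y.
by rewrite !tensor_pi_scale -!tensor_pi_add tensor_pi_scale scalerDr.
Qed.

Fact tensor_scaleDl t : {morph tensor_scale^~ t : k l / k + l}.
Proof.
by move=> k l; elim/tensor_pi_surj: t => x; rewrite !tensor_pi_scale -tensor_pi_add scalerDl.
Qed.

HB.instance Definition _ := GRing.Zmodule_isLmodule.Build K tensor
  tensor_scaleA tensor_scale1 tensor_scaleDr tensor_scaleDl.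

Definition tens (u : U) (v : V) : tensor := pi << (u, v) >>.

Fact tens_bilinear : bilinear_for *:%R *:%R tens.
Proof.
split=> [v k u u'|u k v v'].
  rewrite /tens -[RHS]/(tensor_scale _ _ + _) tensor_pi_scale -tensor_pi_add; apply: tensor_pi_eq.
  exact: tensor_relP.1.
rewrite /tens -[RHS]/(tensor_scale _ _ + _) tensor_pi_scale -tensor_pi_add; apply: tensor_pi_eq.
exact: tensor_relP.2.
Qed.

HB.instance Definition _ := bilinear_isBilinear.Build K U V tensor
  *:%R *:%R tens tens_bilinear.

End Tensor.

Arguments tensor_rel {K} U V : simpl never.

Notation "U ⊗ V" := (tensor U V) (at level 40, left associativity) : type_scope.
Notation "u ⊗ v" := (tens u v) (at level 40, left associativity) : ring_scope.

Section TensorUniversal.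
Context (K : fieldType) (U V W : lmodType K).

Lemma tensor_sum (t : (U ⊗ V)%type) :
  exists s : seq (U * V), t = \sum_(p <- s) p.1 ⊗ p.2.
Proof.
elim/tensor_pi_surj: t => x; rewrite -[x]freeg_sumE.
move: (dom x) => d; exists [seq (coeff z x *: z.1, z.2) | z <- d]; rewrite big_map.
rewrite (raddf_sum \pi_(Quotient.quot (tensor_rel U V))).
apply: eq_bigr => -[u v] _ /=; rewrite linearZl_LR /=.
have -> : << coeff (u, v) x *g (u, v) >> =
          coeff (u, v) x *: << (u, v) >> :> {freeg (U * V)%type / K}.
  by apply/eqP/freeg_eqP => z; rewrite coeffZ !coeffU mul1r.
by rewrite -tensor_pi_scale.
Qed.

Lemma tensor_ext (g h : {linear (U ⊗ V)%type -> W}) :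
  (forall u v, g (u ⊗ v) = h (u ⊗ v)) -> g =1 h.
Proof.
move=> gh t; case: (tensor_sum t) => s ->; rewrite !linear_sum.
by apply: eq_bigr => p _; exact: gh.
Qed.

Lemma tensor_lift (f : {bilinear U -> V -> W}) :
  exists g : {linear (U ⊗ V)%type -> W}, forall u v, g (u ⊗ v) = f u v.
Proof.
pose F := fglift (fun p : U * V => f p.1 p.2).
have FB : {morph F : x y / x - y} by exact: lift_is_additive.
have F0 : F 0 = 0 by rewrite -(subrr 0) FB subrr.
have FD : {morph F : x y / x + y}.
  by move=> x y; rewrite -[in LHS](opprK y) -(sub0r y) !FB F0 sub0r opprK.
have FU k u v : F << k *g (u, v) >> = k *: f u v by rewrite /F liftU.
have FZ k x : F (k *: x) = k *: F x.
  rewrite -[x]freeg_sumE scaler_sumr !(big_morph _ FD F0) scaler_sumr.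
  apply: eq_bigr => -[u v] _; rewrite FU scalerA -FU; congr F.
  by apply/eqP/freeg_eqP => z; rewrite coeffZ !coeffU mulrA.
have Fker x : x \in tensor_rel U V -> F x = 0.
  move=> /asboolP /(_ (fun z => F z = 0)); apply.
    split=> // k y z hy hz.
    by rewrite FD FZ hy hz scaler0 addr0.
  by split=> k *; rewrite FB FD FZ !FU !scale1r /= ?linearPl ?linearPr subrr.
pose g (t : (U ⊗ V)%type) : W :=
  F (repr (t : Quotient.quot (tensor_rel U V))).
have gpi x : g (\pi_(Quotient.quot (tensor_rel U V)) x) = F x.
  apply/eqP; rewrite -subr_eq0 -FB; apply/eqP/Fker.
  by rewrite Quotient.idealrBE reprK.
have glin : linear g.
  move=> k; elim/tensor_pi_surj => x; elim/tensor_pi_surj => y.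
  rewrite -[_ *: _]/(tensor_scale _ _) tensor_pi_scale -tensor_pi_add.
  by rewrite [LHS]gpi (gpi x) (gpi y) FD FZ.
pose gL := GRing.isLinear.Build K _ _ _ g glin.
pose G : {linear (U ⊗ V)%type -> W} := HB.pack g gL.
by exists G => u v; rewrite [LHS]gpi FU scale1r.
Qed.

End TensorUniversal.

Section Graded.
Context (K : fieldType) (G : zmodType).

(* A is the direct sum of the subspaces A_ g: every vector is in a unique way a
   finitely supported sum of components x_g in A_ g. *)
Record is_grading (A : lmodType K) (A_ : G -> set A) : Prop := IsGrading {
  grading_subspace : forall g : G, is_subspace (A_ g);
  grading_direct : forall x : A, exists! f : {fsfun G -> A for fun=> 0},
    (forall g : G, A_ g (f g)) /\ x = \sum_(g <- finsupp f) f g }.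

Definition homogeneous (A : lmodType K) (A_ : G -> set A) (x : A) : Prop :=
  exists g : G, A_ g x.

Record is_bicharacter (eps : G -> G -> K) : Prop := IsBicharacter {
  bichar_neq0 : forall a b : G, eps a b != 0;
  bichar_skew : forall a b : G, eps a b * eps b a = 1;
  bicharDr : forall a b c : G, eps a (b + c) = eps a b * eps a c;
  bicharDl : forall a b c : G, eps (a + b) c = eps a c * eps b c }.

Record hom_assoc_color_algebra (A : lmodType K) (A_ : G -> set A)
    (mu : {bilinear A -> A -> A}) (eps : G -> G -> K)
    (alpha : {linear A -> A}) : Prop := HomAssocColorAlgebra {
  hac_grading : is_grading A_;
  hac_mul_even : forall (a b : G) (x y : A),
    A_ a x -> A_ b y -> A_ (a + b) (mu x y);
  hac_bicharacter : is_bicharacter eps;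
  hac_twist_even : forall (a : G) (x : A), A_ a x -> A_ a (alpha x);
  hac_assoc : forall x y z : A,
    homogeneous A_ x -> homogeneous A_ y -> homogeneous A_ z ->
    mu (alpha x) (mu y z) = mu (mu x y) (alpha z) }.

(* The total grading: in degree c, the span of the u ⊗ v with u and v
   homogeneous and deg u + deg v = c. Scalars are absorbed by the factors. *)
Definition tensor_grading (A1 A2 : lmodType K) (A1_ : G -> set A1)
    (A2_ : G -> set A2) (c : G) : set (A1 ⊗ A2)%type := fun t =>
  exists s : seq (A1 * A2),
    (forall p, p \in s ->
       exists a b : G, [/\ a + b = c, A1_ a p.1 & A2_ b p.2]) /\
    t = \sum_(p <- s) p.1 ⊗ p.2.

Definition tensor_twist_spec (A1 A2 : lmodType K) (A1_ : G -> set A1)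
    (A2_ : G -> set A2) (alpha1 : {linear A1 -> A1})
    (alpha2 : {linear A2 -> A2})
    (alpha : {linear (A1 ⊗ A2)%type -> (A1 ⊗ A2)%type}) : Prop :=
  forall (a1 : A1) (a2 : A2), homogeneous A1_ a1 -> homogeneous A2_ a2 ->
    alpha (a1 ⊗ a2) = alpha1 a1 ⊗ alpha2 a2.

(* eps(a2, b1) is eps evaluated at the degrees g of a2 and h of b1. *)
Definition tensor_mul_spec (A1 A2 : lmodType K) (A1_ : G -> set A1)
    (A2_ : G -> set A2) (eps : G -> G -> K)
    (mu1 : {bilinear A1 -> A1 -> A1}) (mu2 : {bilinear A2 -> A2 -> A2})
    (mu : {bilinear (A1 ⊗ A2)%type -> (A1 ⊗ A2)%type -> (A1 ⊗ A2)%type})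
    : Prop :=
  forall (g h : G) (a1 b1 : A1) (a2 b2 : A2),
    homogeneous A1_ a1 -> A2_ g a2 -> A1_ h b1 -> homogeneous A2_ b2 ->
    mu (a1 ⊗ a2) (b1 ⊗ b2) = eps g h *: (mu1 a1 b1 ⊗ mu2 a2 b2).

End Graded.

(* Main.v *)
(** A grading decomposes every vector into finitely many homogeneous components
    depending linearly on it, so a map into a vector space may be prescribed
    degree by degree, provided it is linear in each degree. Since the sign
    [eps (a2, b1)] depends only on the degrees of [a2] and [b1], this makes the
    product on [A1 ⊗ A2] a quadrilinear map of [(a1, a2, b1, b2)], which descends
    to the tensor products; the same device yields the projections onto the
    total degrees, hence the grading of [A1 ⊗ A2]. Hom-associativity is then
    checked on homogeneous pure tensors, where both sides carry the scalar
    [eps (a2, b1) eps (a2, c1) eps (b2, c1)]. *)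

From HB Require Import structures.
Require Import Defs.
From mathcomp Require Import all_boot all_order all_algebra.
From mathcomp Require Import finmap boolp classical_sets functions.

Set Implicit Arguments.
Unset Strict Implicit.
Unset Printing Implicit Defensive.

Import GRing.Theory.
Local Open Scope ring_scope.

(** * Bundled linear and bilinear maps from plain functions *)

Lemma linear_map_exists (K : fieldType) (A W : lmodType K) (f : A -> W) :
  linear f -> exists F : {linear A -> W}, F =1 f.
Proof.
move=> fL; pose fM := GRing.isLinear.Build K _ _ _ f fL.
by exists (HB.pack f fM : {linear A -> W}).
Qed.

Lemma bilinear_map_exists (K : fieldType) (A B W : lmodType K)
  (f : A -> B -> W) :
  (forall y, linear (f^~ y)) -> (forall x, linear (f x)) ->
  exists F : {bilinear A -> B -> W}, F =2 f.
Proof.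
move=> fl fr; have fB : bilinear_for *:%R *:%R f by split.
pose fM := bilinear_isBilinear.Build K A B W *:%R *:%R f fB.
by exists (HB.pack f fM : {bilinear A -> B -> W}).
Qed.

Lemma linear_fun0 (K : fieldType) (A W : lmodType K) (f : A -> W) :
  linear f -> f 0 = 0.
Proof.
by move=> fL; have [F FE] := linear_map_exists fL; rewrite -FE linear0.
Qed.

(** * Finite decompositions into homogeneous vectors *)

Section Decomposition.
Context (K : fieldType) (G : zmodType) (A : lmodType K) (A_ : G -> set A).

Local Notation fam := {fsfun G -> A for fun=> 0}.

Definition decomposes (f : fam) (x : A) : Prop :=
  (forall g, A_ g (f g)) /\ x = \sum_(g <- finsupp f) f g.

(** Terms off the support vanish, so sums over different supports can be compared over one finite
    set. *)
Lemma big_finsupp (W : zmodType) (f : fam) (F : G -> A -> W) (S : {fset G}) :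
  (forall g, F g 0 = 0) -> (finsupp f `<=` S)%fset ->
  \sum_(g <- finsupp f) F g (f g) = \sum_(g <- S) F g (f g).
Proof.
by move=> F0 sub; apply: big_fset_incl => // g _ /fsfun_dflt ->.
Qed.

Hypothesis A_sub : forall g, is_subspace (A_ g).

Lemma decomposes_linear k f f' x x' :
  decomposes f x -> decomposes f' x' ->
  exists2 f'' : fam, decomposes f'' (k *: x + x') &
    forall g, f'' g = k *: f g + f' g.
Proof.
move=> [fA ->] [f'A ->].
pose S := (finsupp f `|` finsupp f')%fset.
pose f'' : fam := [fsfun g in S => k *: f g + f' g].
have fE g : f'' g = k *: f g + f' g.
  rewrite fsfunE; case: ifPn => //; rewrite in_fsetU negb_or.
  by case/andP => /fsfun_dflt -> /fsfun_dflt ->; rewrite scaler0 addr0.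
exists f''; last exact: fE.
split=> [g|]; first by rewrite fE; case: (A_sub g) => _; apply.
have sS : (finsupp f'' `<=` S)%fset by apply: finsupp_sub.
rewrite (big_finsupp (f := f) (F := fun _ => id) (S := S)) ?fsubsetUl //.
rewrite (big_finsupp (f := f') (F := fun _ => id) (S := S)) ?fsubsetUr //.
rewrite (big_finsupp (f := f'') (F := fun _ => id) (S := S)) //.
by rewrite scaler_sumr -big_split; apply: eq_bigr => g _; rewrite fE.
Qed.

Lemma decomposes_homogeneous g x :
  A_ g x -> exists2 f : fam, decomposes f x &
    forall h, f h = if h == g then x else 0.
Proof.
move=> gx; pose f : fam := [fsfun h in [fset g]%fset => x].
have fE h : f h = if h == g then x else 0 by rewrite fsfunE in_fset1.
exists f => //; split=> [h|].
  by rewrite fE; case: eqP => [->//|_]; case: (A_sub h).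
have sS : (finsupp f `<=` [fset g])%fset by apply: finsupp_sub.
by rewrite (big_finsupp (F := fun _ => id) _ sS) // big_seq_fset1 fE eqxx.
Qed.

(** Applying [P g] to a decomposition isolates its term of degree [g], which gives uniqueness.
    Existence follows by adding up decompositions of the homogeneous summands. *)
Lemma is_grading_of_projections (P : G -> {linear A -> A}) :
  (forall g h x, A_ h x -> P g x = if h == g then x else 0) ->
  (forall x, exists2 s : seq A,
     (forall y, y \in s -> homogeneous A_ y) & x = \sum_(y <- s) y) ->
  is_grading A_.
Proof.
move=> PE span; split=> // x.
have PD f g y : decomposes f y -> P g y = f g.
  move=> [fA ->]; rewrite linear_sum.
  under eq_bigr => h _ do rewrite (PE g h _ (fA h)).
  (* The degree [g] may lie outside the support of [f], so it is adjoined before its term is singled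
     out. *)
  rewrite (big_finsupp (F := fun h u => if h == g then u else 0)
             (S := (g |` finsupp f)%fset)) ?fsubsetU1 //; last by move=> h; case: ifP.
  rewrite (bigD1_seq g) ?fset_uniq ?fset1U1 //= eqxx big1 ?addr0 // => h.
  by move/negPf => ->.
suff [f fx] : exists f, decomposes f x.
  exists f; split=> // f' f'x; apply/fsfunP => g.
  by rewrite -(PD f g x fx) -(PD f' g x f'x).
have [s sA ->] := span x; elim: s sA => [_|y s IH sA].
  (* The empty sum is treated as a homogeneous vector of degree 0. *)
  rewrite big_nil; have [f f0 _] := decomposes_homogeneous (A_sub 0).1.
  by exists f.
rewrite big_cons; have [|f fs] := IH.
  by move=> z zs; apply: sA; rewrite inE zs orbT.
have [g gy] := sA y (mem_head _ _).
have [f' f'y _] := decomposes_homogeneous gy.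
have [f'' f''D _] := decomposes_linear 1 f'y fs.
by exists f''; rewrite scale1r in f''D.
Qed.

End Decomposition.

Arguments decomposes {K G A} A_ f x.

(** * Homogeneous components and maps prescribed degree by degree *)

Section Graded.
Context {K : fieldType} {G : zmodType} {A : lmodType K} {A_ : G -> set A}.
Hypothesis HA : is_grading A_.

Definition component (x : A) : {fsfun G -> A for fun=> 0} :=
  projT1 (cid (grading_direct HA x)).

Lemma component_decomposes x : decomposes A_ (component x) x.
Proof. exact: (projT2 (cid (grading_direct HA x))).1. Qed.

Lemma component_unique f x : decomposes A_ f x -> component x = f.
Proof. exact: (projT2 (cid (grading_direct HA x))).2. Qed.

(** Combining two decompositions termwise decomposes the combined vector, and decompositions are
    unique. *)
Lemma component_linear k x y g :
  component (k *: x + y) g = k *: component x g + component y g.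
Proof.
have [f fD <-] := decomposes_linear (grading_subspace HA) k
  (component_decomposes x) (component_decomposes y).
by rewrite (component_unique fD).
Qed.

Lemma component_homogeneous g x h :
  A_ g x -> component x h = if h == g then x else 0.
Proof.
move=> gx.
have [f fD <-] := decomposes_homogeneous (grading_subspace HA) gx.
by rewrite (component_unique fD).
Qed.

Lemma graded_ind (P : A -> Prop) :
  P 0 -> (forall x y, P x -> P y -> P (x + y)) ->
  (forall g x, A_ g x -> P x) -> forall x, P x.
Proof.
move=> P0 PD Ph x; have [fA ->] := component_decomposes x.
by apply: (big_ind P) => // g _; apply: Ph (fA g).
Qed.

(** When every [f g] sends 0 to 0, this map agrees with [f g] on each [A_ g]. *)
Definition graded_sum {W : zmodType} (f : G -> A -> W) (x : A) : W :=
  \sum_(g <- finsupp (component x)) f g (component x g).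

Lemma graded_sum_linear (W : lmodType K) (f : G -> A -> W) :
  (forall g, linear (f g)) -> linear (graded_sum f).
Proof.
move=> fL k x y; rewrite /graded_sum.
have f0 g : f g 0 = 0 by apply: linear_fun0.
pose S := (finsupp (component (k *: x + y)) `|`
           (finsupp (component x) `|` finsupp (component y)))%fset.
rewrite !(big_finsupp (S := S) f0) ?fsubsetUl //; first last.
- by rewrite /S fsetUCA fsubsetUl.
- by rewrite /S fsetUA fsubsetUr.
rewrite scaler_sumr -big_split; apply: eq_bigr => g _.
by rewrite component_linear fL.
Qed.

Lemma graded_sum_homogeneous (W : zmodType) (f : G -> A -> W) g x :
  (forall h, f h 0 = 0) -> A_ g x -> graded_sum f x = f g x.
Proof.
move=> f0 gx; rewrite /graded_sum.
rewrite (big_finsupp (F := f) (S := (g |` finsupp (component x))%fset)) ?fsubsetU1 //.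
rewrite (bigD1_seq g) ?fset_uniq ?fset1U1 //=.
rewrite (component_homogeneous g gx) eqxx big1 ?addr0 // => h /negPf hg.
by rewrite (component_homogeneous h gx) hg.
Qed.

(** For fixed [x] all three sums run over the same support. This yields linearity in any parameter
    on which the family depends linearly. *)
Lemma graded_sum_combination (W : lmodType K) k (f f' f'' : G -> A -> W) x :
  (forall g u, f'' g u = k *: f g u + f' g u) ->
  graded_sum f'' x = k *: graded_sum f x + graded_sum f' x.
Proof.
by move=> fE; rewrite scaler_sumr -big_split; apply: eq_bigr => g _.
Qed.

End Graded.

(** * Maps of two variables prescribed by a pair of degrees *)

Section GradedSum2.
Context {K : fieldType} {G : zmodType} {A B : lmodType K}.
Context {A_ : G -> set A} {B_ : G -> set B}.
Hypotheses (HA : is_grading A_) (HB : is_grading B_).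
Context {W : lmodType K}.

Definition graded_sum2 (f : G -> G -> A -> B -> W) (x : A) (y : B) : W :=
  graded_sum HA (fun g u => graded_sum HB (fun h v => f g h u v) y) x.

Lemma graded_sum2_linearl f y :
  (forall g h v, linear (fun u => f g h u v)) ->
  linear (fun x => graded_sum2 f x y).
Proof.
move=> fL; apply: graded_sum_linear => g k u u'.
by apply: graded_sum_combination => h v; apply: fL.
Qed.

Lemma graded_sum2_linearr f x :
  (forall g h u, linear (f g h u)) -> linear (graded_sum2 f x).
Proof.
move=> fL k y y'; apply: graded_sum_combination => g u.
by apply: graded_sum_linear => h; apply: fL.
Qed.

Lemma graded_sum2_combination k f f' f'' x y :
  (forall g h u v, f'' g h u v = k *: f g h u v + f' g h u v) ->
  graded_sum2 f'' x y = k *: graded_sum2 f x y + graded_sum2 f' x y.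
Proof.
by move=> fE; apply: graded_sum_combination => g u; apply: graded_sum_combination.
Qed.

Lemma graded_sum2_homogeneous f g h x y :
  (forall g h v, linear (fun u => f g h u v)) ->
  (forall g h u, linear (f g h u)) ->
  A_ g x -> B_ h y -> graded_sum2 f x y = f g h x y.
Proof.
move=> fl fr gx hy; rewrite /graded_sum2.
rewrite (graded_sum_homogeneous HA (g := g)) // => [|g'].
  by apply: graded_sum_homogeneous => // h'; exact: (linear_fun0 (fr g h' x)).
(* The outer family vanishes at 0 because every term of the inner sum is linear in [u]. *)
by rewrite /graded_sum big1 // => h' _; exact: (linear_fun0 (fl g' h' _)).
Qed.

End GradedSum2.

(** * Quadrilinear maps as bilinear maps on tensor products *)

Lemma tensor_lift_quadrilinear (K : fieldType) (A B C D W : lmodType K)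
  (f : A -> B -> C -> D -> W) :
  (forall b c d, linear (fun a => f a b c d)) ->
  (forall a c d, linear (fun b => f a b c d)) ->
  (forall a b d, linear (fun c => f a b c d)) ->
  (forall a b c, linear (f a b c)) ->
  exists F : {bilinear (A ⊗ B)%type -> (C ⊗ D)%type -> W},
    forall a b c d, F (a ⊗ b) (c ⊗ d) = f a b c d.
Proof.
move=> fa fb fc fd.
(* The universal property is used twice: first in [(c, d)] for fixed [a] and [b], then in [(a, b)]
   with functions on [C ⊗ D] as values. *)
have lift2 a b : exists g : {linear (C ⊗ D)%type -> W},
    forall c d, g (c ⊗ d) = f a b c d.
  have [g gE] := bilinear_map_exists (f := f a b) (fun d => fc a b d) (fd a b).
  by have [h hE] := tensor_lift g; exists h => c d; rewrite hE gE.
pose g a b := projT1 (cid (lift2 a b)).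
have gE a b c d : g a b (c ⊗ d) = f a b c d.
  by rewrite /g; case: cid => /= ? ->.
(* As [C ⊗ D -> W] is a vector space, [tensor_lift] applies to [g']. *)
pose g' a b : (C ⊗ D)%type -> W := g a b.
(* Each [g a b] is chosen separately, but its values on pure tensors determine it, so it inherits
   the linearity of [f] in [a] and in [b]. *)
have gl b : linear (g'^~ b).
  move=> k a a'; apply/funext => t; have [s ->] := tensor_sum t.
  rewrite /g' -[RHS]/(k *: (g a b _) + g a' b _) !linear_sum -big_split.
  by apply: eq_bigr => -[c d] _; rewrite !gE fa.
have gr a : linear (g' a).
  move=> k b b'; apply/funext => t; have [s ->] := tensor_sum t.
  rewrite /g' -[RHS]/(k *: (g a b _) + g a b' _) !linear_sum -big_split.
  by apply: eq_bigr => -[c d] _; rewrite !gE fb.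
have [h hE] := bilinear_map_exists gl gr.
have [F FE] := tensor_lift h.
have Fl y : linear (fun x => F x y).
  by move=> k x x'; rewrite linearP.
(* The second lift has plain functions as values. Linearity in [y] is recovered by writing [x] as a
   sum of pure tensors, since [F (a ⊗ b)] is the linear map [g a b]. *)
have Fr x : linear (F x).
  have [s ->] := tensor_sum x; move=> k y y'; rewrite !linear_sum.
  elim: s => [|[a b] s IH]; first by rewrite !big_nil scaler0 addr0.
  rewrite !big_cons -![(_ + \sum_(_ <- s) _) _]/(_ _ + _ _) IH /= !FE !hE /g' linearP.
  by rewrite scalerDr addrACA.
have [M ME] := bilinear_map_exists Fl Fr.
by exists M => a b c d; rewrite ME FE hE /g' gE.
Qed.

(** * The total grading of the tensor product *)

Section TensorGrading.
Context {K : fieldType} {G : zmodType} {A1 A2 : lmodType K}.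
Context {A1_ : G -> set A1} {A2_ : G -> set A2}.
Hypotheses (HA1 : is_grading A1_) (HA2 : is_grading A2_).

Local Notation T_ := (tensor_grading A1_ A2_).

Lemma tensor_grading_tens a b u v :
  A1_ a u -> A2_ b v -> T_ (a + b) (u ⊗ v).
Proof.
move=> au bv; exists [:: (u, v)]; rewrite big_seq1; split=> // p.
by rewrite inE => /eqP ->; exists a, b.
Qed.

Lemma tensor_grading_subspace c : is_subspace (T_ c).
Proof.
split; first by exists [::]; rewrite big_nil.
move=> k _ _ [s [sA ->]] [s' [s'A ->]].
exists ([seq (k *: p.1, p.2) | p <- s] ++ s'); split.
  move=> p; rewrite mem_cat => /orP[/mapP[q qs ->]|]; last exact: s'A.
  have [a [b [abc aq bq]]] := sA q qs; exists a, b; split=> //=.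
  have [h0 h] := grading_subspace HA1 a.
  by rewrite -[_ *: _]addr0; apply: h.
rewrite big_cat big_map scaler_sumr; congr (_ + _).
by apply: eq_bigr => p _; rewrite linearZl_LR.
Qed.

Lemma tensor_grading_sum c (I : eqType) (s : seq I) (F : I -> (A1 ⊗ A2)%type) :
  (forall i, i \in s -> T_ c (F i)) -> T_ c (\sum_(i <- s) F i).
Proof.
move=> sF; rewrite big_seq; have [T0 TL] := tensor_grading_subspace c.
by apply: big_ind => // x y cx cy; rewrite -[x]scale1r; apply: TL.
Qed.

(** Tensors are sums of pure tensors, whose two factors split in turn into homogeneous
    components. *)
Lemma tensor_graded_ind (P : (A1 ⊗ A2)%type -> Prop) :
  P 0 -> (forall x y, P x -> P y -> P (x + y)) ->
  (forall a b u v, A1_ a u -> A2_ b v -> P (u ⊗ v)) -> forall t, P t.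
Proof.
move=> P0 PD Ph t; have [s ->] := tensor_sum t.
apply: (big_ind P) => // -[u v] _ /=.
elim/(graded_ind HA1): u => [|u u' Pu Pu'|a u au].
- by rewrite linear0l.
- by rewrite linearDl; apply: PD.
elim/(graded_ind HA2): v => [|v v' Pv Pv'|b v bv].
- by rewrite linear0r.
- by rewrite linearDr; apply: PD.
exact: Ph au bv.
Qed.

(** The projection onto degree [c] keeps [u ⊗ v] if the degrees of [u] and [v] add up to [c] and
    kills it otherwise. This rule is bilinear for each pair of degrees, hence extends. *)
Lemma tensor_grading_proj :
  exists P : G -> {linear (A1 ⊗ A2)%type -> (A1 ⊗ A2)%type},
  forall c d t, T_ d t -> P c t = if d == c then t else 0.
Proof.
pose f (c a b : G) (u : A1) (v : A2) := if a + b == c then u ⊗ v else 0.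
have fl c a b v : linear (fun u => f c a b u v).
  by move=> k u u'; rewrite /f; case: ifP => _; rewrite ?linearPl // scaler0 addr0.
have fr c a b u : linear (f c a b u).
  by move=> k v v'; rewrite /f; case: ifP => _; rewrite ?linearPr // scaler0 addr0.
have proj c : exists P : {linear (A1 ⊗ A2)%type -> (A1 ⊗ A2)%type},
    forall a b u v, A1_ a u -> A2_ b v -> P (u ⊗ v) = f c a b u v.
  have [F FE] := bilinear_map_exists (f := graded_sum2 HA1 HA2 (f c))
    (fun y => graded_sum2_linearl HA1 HA2 y (fl c))
    (fun x => graded_sum2_linearr HA1 HA2 x (fr c)).
  have [P PE] := tensor_lift F; exists P => a b u v au bv.
  by rewrite PE FE (graded_sum2_homogeneous HA1 HA2 (g := a) (h := b)).
exists (fun c => projT1 (cid (proj c))) => c d _ [s [sA ->]].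
case: cid => P PE /=; rewrite linear_sum.
(* The summands may have different pairs of degrees, but each pair adds up to [d], so all are kept
   or all are killed. *)
transitivity (\sum_(p <- s) if d == c then p.1 ⊗ p.2 else 0).
  rewrite big_seq [RHS]big_seq; apply: eq_bigr => p /sA [a [b [<- ap bp]]].
  by rewrite (PE a b).
by case: ifP => // _; rewrite big1.
Qed.

Lemma tensor_is_grading : is_grading T_.
Proof.
have [P PE] := tensor_grading_proj.
apply: (is_grading_of_projections tensor_grading_subspace PE).
elim/tensor_graded_ind => [|x y [s sT ->] [s' s'T ->]|a b u v au bv].
- by exists [::]; rewrite ?big_nil.
- exists (s ++ s'); last by rewrite big_cat.
  by move=> z; rewrite mem_cat => /orP[/sT|/s'T].
- exists [:: u ⊗ v]; last by rewrite big_seq1.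
  by move=> y; rewrite inE => /eqP ->; exists (a + b); apply: tensor_grading_tens.
Qed.

End TensorGrading.

(** * The twist and the product on the tensor product *)

Lemma tensor_map_exists (K : fieldType) (A B C D : lmodType K)
  (f : {linear A -> C}) (g : {linear B -> D}) :
  exists h : {linear (A ⊗ B)%type -> (C ⊗ D)%type},
    forall u v, h (u ⊗ v) = f u ⊗ g v.
Proof.
have [F FE] : exists F : {bilinear A -> B -> (C ⊗ D)%type},
    F =2 (fun u v => f u ⊗ g v).
  by apply: bilinear_map_exists => [v|u] k x y; rewrite linearP ?linearPl ?linearPr.
by have [h hE] := tensor_lift F; exists h => u v; rewrite hE FE.
Qed.

Lemma color_mul_exists (K : fieldType) (G : zmodType) (A1 A2 : lmodType K)
  (A1_ : G -> set A1) (A2_ : G -> set A2) (eps : G -> G -> K)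
  (mu1 : {bilinear A1 -> A1 -> A1}) (mu2 : {bilinear A2 -> A2 -> A2}) :
  is_grading A1_ -> is_grading A2_ ->
  exists mu : {bilinear (A1 ⊗ A2)%type -> (A1 ⊗ A2)%type -> (A1 ⊗ A2)%type},
    forall g h a1 a2 b1 b2, A2_ g a2 -> A1_ h b1 ->
      mu (a1 ⊗ a2) (b1 ⊗ b2) = eps g h *: (mu1 a1 b1 ⊗ mu2 a2 b2).
Proof.
move=> HA1 HA2.
(* The scalar depends on the degrees of [a2] and [b1] only, so [a1] and [b2] are put first, as
   parameters of the family. *)
pose m a1 b2 g h a2 b1 := eps g h *: (mu1 a1 b1 ⊗ mu2 a2 b2).
have m1 b2 g h a2 b1 : linear (fun a1 => m a1 b2 g h a2 b1).
  by move=> k x y; rewrite /m !linearPl scalerDr !scalerA mulrC.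
have m2 a1 g h a2 b1 : linear (fun b2 => m a1 b2 g h a2 b1).
  by move=> k x y; rewrite /m !linearPr scalerDr !scalerA mulrC.
have m3 a1 b2 g h b1 : linear (fun a2 => m a1 b2 g h a2 b1).
  by move=> k x y; rewrite /m linearPl linearPr scalerDr !scalerA mulrC.
have m4 a1 b2 g h a2 : linear (m a1 b2 g h a2).
  by move=> k x y; rewrite /m linearPr linearPl scalerDr !scalerA mulrC.
pose f a1 a2 b1 b2 := graded_sum2 HA2 HA1 (m a1 b2) a2 b1.
(* Linearity in [a1] and [b2] comes from the family, linearity in [a2] and [b1] from
   [graded_sum2]. *)
have [|||| mu muE] := tensor_lift_quadrilinear (f := f).
- by move=> a2 b1 b2 k x y; apply: graded_sum2_combination => *; apply: m1.
- by move=> a1 b1 b2; apply: graded_sum2_linearl.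
- by move=> a1 a2 b2; apply: graded_sum2_linearr.
- by move=> a1 a2 b1 k x y; apply: graded_sum2_combination => *; apply: m2.
exists mu => g h a1 a2 b1 b2 ga2 hb1; rewrite muE.
exact: graded_sum2_homogeneous.
Qed.

(** * Existence and uniqueness of twist and product, and the axioms *)

Theorem theorem2p2 (K : fieldType) (charK : 2%N \notin [pchar K])
  (G : zmodType) (A1 A2 : lmodType K)
  (A1_ : G -> set A1) (A2_ : G -> set A2)
  (mu1 : {bilinear A1 -> A1 -> A1}) (mu2 : {bilinear A2 -> A2 -> A2})
  (eps : G -> G -> K)
  (alpha1 : {linear A1 -> A1}) (alpha2 : {linear A2 -> A2})
  (H1 : hom_assoc_color_algebra A1_ mu1 eps alpha1)
  (H2 : hom_assoc_color_algebra A2_ mu2 eps alpha2) :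
  exists (alpha : {linear (A1 ⊗ A2)%type -> (A1 ⊗ A2)%type})
    (mu : {bilinear (A1 ⊗ A2)%type -> (A1 ⊗ A2)%type -> (A1 ⊗ A2)%type}),
    [/\ tensor_twist_spec A1_ A2_ alpha1 alpha2 alpha /\
          (forall alpha', tensor_twist_spec A1_ A2_ alpha1 alpha2 alpha' ->
             alpha' =1 alpha),
        tensor_mul_spec A1_ A2_ eps mu1 mu2 mu /\
          (forall mu', tensor_mul_spec A1_ A2_ eps mu1 mu2 mu' -> mu' =2 mu)
      & hom_assoc_color_algebra (tensor_grading A1_ A2_) mu eps alpha].
Proof.
have [gr1 even1 bich aeven1 assoc1] := H1.
have [gr2 even2 _ aeven2 assoc2] := H2.
have [alpha alphaE] := tensor_map_exists alpha1 alpha2.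
have [mu muE] := color_mul_exists eps mu1 mu2 gr1 gr2.
exists alpha, mu; split; first split=> [u v _ _|alpha' alpha'E].
- exact: alphaE.
(* Additive maps that agree on homogeneous pure tensors are equal. *)
- elim/(tensor_graded_ind gr1 gr2) => [|x y IHx IHy|a b u v au bv].
  + by rewrite !linear0.
  + by rewrite !linearD IHx IHy.
  + by rewrite alphaE alpha'E //; [exists a|exists b].
- split=> [g h a1 b1 a2 b2 _ ga2 hb1 _|mu' mu'E x y]; first exact: muE.
  elim/(tensor_graded_ind gr1 gr2): x => [|x x' IHx IHx'|a b u v au bv].
  + by rewrite !linear0l.
  + by rewrite !linearDl IHx IHx'.
  elim/(tensor_graded_ind gr1 gr2): y => [|y y' IHy IHy'|c d w z cw dz].
  + by rewrite !linear0r.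
  + by rewrite !linearDr IHy IHy'.
  by rewrite (muE b c) // (mu'E b c) //; [exists a|exists d].
split=> //.
- exact: tensor_is_grading.
- move=> c d _ _ [s [sA ->]] [s' [s'A ->]].
  rewrite linear_sumlz.
  apply: (tensor_grading_sum gr1) => p /sA [a [b [<- ap bp]]].
  rewrite linear_sumr.
  apply: (tensor_grading_sum gr1) => q /s'A [a' [b' [<- aq bq]]].
  rewrite (muE b a') // -[_ *: _]addr0.
  have [T0 TL] := tensor_grading_subspace gr1 (A2_ := A2_) (a + b + (a' + b')).
  apply: TL => //.
  (* Commutativity of [G] regroups the degree as [(a + a') + (b + b')]. *)
  by rewrite addrACA; apply: tensor_grading_tens; [apply: even1|apply: even2].
- move=> c _ [s [sA ->]]; rewrite linear_sum; apply: (tensor_grading_sum gr1) => p.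
  move=> /sA [a [b [<- ap bp]]]; rewrite alphaE.
  by apply: tensor_grading_tens; [apply: aeven1|apply: aeven2].
move=> x y z _ _ _.
(* Both sides are additive in each of [x], [y] and [z], which reduces the identity to homogeneous
   pure tensors. *)
elim/(tensor_graded_ind gr1 gr2): x => [|x x' IH IH'|a1 a2 x1 x2 hx1 hx2].
- by rewrite linear0 !linear0l.
- by rewrite linearD !linearDl IH IH'.
elim/(tensor_graded_ind gr1 gr2): y => [|y y' IH IH'|b1 b2 y1 y2 hy1 hy2].
- by rewrite linear0l !linear0r linear0l.
- by rewrite linearDl !linearDr linearDl IH IH'.
elim/(tensor_graded_ind gr1 gr2): z => [|z z' IH IH'|c1 c2 z1 z2 hz1 hz2].
- by rewrite [alpha 0]linear0 !linear0r.
- by rewrite [alpha (z + z')]linearD !linearDr IH IH'.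
rewrite !alphaE (muE b2 c1) // (muE a2 b1) // linearZr_LR linearZl_LR /=.
(* The twists preserve degrees and the products add them, which fixes the degrees at which [eps] is
   evaluated. *)
rewrite (muE a2 (b1 + c1)) //; [|exact: aeven2|exact: even1].
rewrite (muE (a2 + b2) c1) //; [|exact: even2|exact: aeven1].
rewrite assoc1; [|by exists a1|by exists b1|by exists c1].
rewrite assoc2; [|by exists a2|by exists b2|by exists c2].
(* It remains to compare [eps b2 c1 * eps a2 (b1 + c1)] with [eps a2 b1 * eps (a2 + b2) c1]. *)
rewrite !scalerA (bicharDr bich) (bicharDl bich); congr (_ *: _).
by rewrite mulrC -mulrA.
Qed.
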